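(* Let $\mathcal{M}=(\mathbb{R}^2,\nabla)$ be a Type $\mathcal{A}$ geometry. Then there exists a linear function $\varphi(x^1,x^2)=a_1x^1+a_2x^2$, with $(a_1,a_2)\in\mathbb{R}^2$, which provides a strong projective equivalence from $\mathcal{M}$ to a flat Type $\mathcal{A}$ geometry (that is, ${}^{\varphi}\mathcal{M}$ is a flat Type $\mathcal{A}$ geometry) and which satisfies $e^{-\varphi}\in\mathcal{Q}(\mathcal{M})$.
   Context: An affine surface is a pair $(M,\nabla)$ where $M$ is a connected smooth surface and $\nabla$ is a torsion free connection on $TM$. In local coordinates write $\nabla_{\partial_{x^i}}\partial_{x^j}=\Gamma_{ij}{}^k\partial_{x^k}$ (summation convention). A Type $\mathcal{A}$ geometry is an affine surface $(\mathbb{R}^2,\nabla)$ whose Christoffel symbols $\Gamma_{ij}{}^k=\Gamma_{ji}{}^k$ in the standard coordinates $(x^1,x^2)$ are constant. The curvature operator is $R(u,v)=\nabla_u\nabla_v-\nabla_v\nabla_u-\nabla_{[u,v]}$; $\nabla$ is flat if $R=0$. The Ricci tensor is $\rho(x,y)=\operatorname{Tr}\{z\mapsto R(z,x)y\}$ and $\rho_s(x,y)=\frac12\{\rho(x,y)+\rho(y,x)\}$. The Hessian of a smooth function $\phi$ is $\mathcal{H}\phi=(\partial_{x^i}\partial_{x^j}\phi-\Gamma_{ij}{}^k\partial_{x^k}\phi)\,dx^i\otimes dx^j$. The solution space of the quasi-Einstein equation is $\mathcal{Q}(\mathcal{M})=\{\phi\in C^\infty(M):\mathcal{H}\phi+\phi\rho_s=0\}$.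 A smooth function $\varphi$ provides a strong projective equivalence from $\mathcal{M}=(M,\nabla)$ to ${}^{\varphi}\mathcal{M}:=(M,\tilde\nabla)$ if $\tilde\nabla_XY=\nabla_XY+Y(\varphi)X+X(\varphi)Y$ for all vector fields $X,Y$. *)

(* Defs.v *)
From mathcomp Require Import all_boot all_order all_algebra.
From mathcomp Require Import all_classical all_reals all_analysis.
Import Order.TTheory GRing.Theory Num.Theory.
Import numFieldNormedType.Exports.

Set Implicit Arguments.
Unset Strict Implicit.
Unset Printing Implicit Defensive.

Local Open Scope classical_set_scope.
Local Open Scope ring_scope.

(* Points of the plane and tangent vectors are both row vectors; the
   coordinates (x^1, x^2) of x are x ord0 0 and x ord0 1. *)
Definition scalar_field (R : realType) := 'rV[R]_2 -> R.
Definition vector_field (R : realType) := 'rV[R]_2 -> 'rV[R]_2.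

Fixpoint is_Ck (R : realType) (W : normedModType R) (n : nat)
    (f : 'rV[R]_2 -> W) : Prop :=
  if n is m.+1 then
    (forall x, differentiable f x) /\ (forall v, is_Ck m (fun x => 'D_v f x))
  else continuous f.

Definition smooth (R : realType) (W : normedModType R)
    (f : 'rV[R]_2 -> W) : Prop :=
  forall n, is_Ck n f.

Section AffineGeometry.
Context {R : realType}.
Implicit Types (X Y Z : vector_field R) (f phi : scalar_field R).

Definition coord_field (i : 'I_2) : vector_field R := fun=> delta_mx ord0 i.

Definition lie_bracket X Y : vector_field R :=
  fun p => 'D_(X p) Y p - 'D_(Y p) X p.

(* Only the values of an operator on smooth vector fields are meaningful. *)
Definition field_operator :=
  vector_field R -> vector_field R -> vector_field R.

Implicit Type nabla : field_operator.

Record is_connection nabla : Prop := IsConnection {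
  connection_smooth : forall X Y, smooth X -> smooth Y -> smooth (nabla X Y);
  connection_addl : forall X X' Y, smooth X -> smooth X' -> smooth Y ->
    forall p, nabla (X \+ X') Y p = nabla X Y p + nabla X' Y p;
  connection_scalel : forall f X Y, smooth f -> smooth X -> smooth Y ->
    forall p, nabla (fun q => f q *: X q) Y p = f p *: nabla X Y p;
  connection_addr : forall X Y Y', smooth X -> smooth Y -> smooth Y' ->
    forall p, nabla X (Y \+ Y') p = nabla X Y p + nabla X Y' p;
  connection_leibniz : forall f X Y, smooth f -> smooth X -> smooth Y ->
    forall p, nabla X (fun q => f q *: Y q) p =
              'D_(X p) f p *: Y p + f p *: nabla X Y p
}.

Definition torsion_free nabla : Prop :=
  forall X Y, smooth X -> smooth Y ->
  forall p, nabla X Y p - nabla Y X p = lie_bracket X Y p.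

Definition christoffel nabla (i j k : 'I_2) : scalar_field R :=
  fun p => nabla (coord_field i) (coord_field j) p ord0 k.

Definition affine_plane nabla : Prop :=
  is_connection nabla /\ torsion_free nabla.

Definition type_A nabla : Prop :=
  affine_plane nabla /\
  forall i j k, exists c : R, forall p, christoffel nabla i j k p = c.

Definition curvature nabla X Y Z : vector_field R :=
  fun p => nabla X (nabla Y Z) p - nabla Y (nabla X Z) p
           - nabla (lie_bracket X Y) Z p.

Definition flat nabla : Prop :=
  forall X Y Z, smooth X -> smooth Y -> smooth Z ->
  forall p, curvature nabla X Y Z p = 0.

(* The trace is taken in the coordinate frame: row i of the matrix is the
   image of the i-th coordinate vector under z |-> R(z, X) Y. *)
Definition ricci nabla X Y : scalar_field R :=
  fun p => \tr (\matrix_(i < 2, j < 2)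
                  curvature nabla (coord_field i) X Y p ord0 j).

Definition ricci_sym nabla X Y : scalar_field R :=
  fun p => 2^-1 * (ricci nabla X Y p + ricci nabla Y X p).

Definition partial_derivative (i : 'I_2) f : scalar_field R :=
  fun p => 'D_(delta_mx ord0 i) f p.

Definition hessian nabla phi X Y : scalar_field R :=
  fun p => \sum_(i < 2) \sum_(j < 2)
    (partial_derivative i (partial_derivative j phi) p
     - \sum_(k < 2) christoffel nabla i j k p * partial_derivative k phi p)
    * X p ord0 i * Y p ord0 j.

Definition quasi_einstein_solution nabla phi : Prop :=
  smooth phi /\
  forall X Y, smooth X -> smooth Y ->
  forall p, hessian nabla phi X Y p + phi p * ricci_sym nabla X Y p = 0.

Definition strong_projective_equivalence phi nabla nabla' : Prop :=
  smooth phi /\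
  forall X Y, smooth X -> smooth Y ->
  forall p, nabla' X Y p =
    nabla X Y p + 'D_(Y p) phi p *: X p + 'D_(X p) phi p *: Y p.

Definition linear_function (a1 a2 : R) : scalar_field R :=
  fun x => a1 * x ord0 0 + a2 * x ord0 1.

End AffineGeometry.

Arguments field_operator : clear implicits.

(* Main.v *)
Require Import Defs.
From mathcomp Require Import all_boot all_order all_algebra.
From mathcomp Require Import all_classical all_reals all_analysis.
From mathcomp Require Import ring lra.
Import Order.TTheory GRing.Theory Num.Theory.
Import numFieldNormedType.Exports.
Set Implicit Arguments.
Unset Strict Implicit.
Unset Printing Implicit Defensive.
Local Open Scope classical_set_scope.
Local Open Scope ring_scope.

(** In standard coordinates the connection is the derivative of fields plus a
    constant symmetric bilinear product [u * v] on the plane, that is, a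
    two-dimensional commutative algebra ([type_A_is_constant]). Its curvature is
    the commutator of multiplication operators ([curvature_constant]), and adding
    a linear form [a] as in a strong projective equivalence replaces the product
    by [u * v + a(u) v + a(v) u]. So a form is needed for which all
    multiplication operators of the new product commute.

    In dimension two it suffices that multiplication by one nonzero vector be
    scalar. The real plane has a direction [x] with [x * x] proportional to [x],
    found as a zero of a function on the circle that changes
    sign under the half-turn ([eigendirection]); for such an [x]
    the requirement that multiplication by [x] be scalar is met by an explicit
    [a] ([commuting_shift]). This yields the flat connection.

    The quasi-Einstein equation then costs nothing more: the Ricci tensor of the
    shifted connection is that of the original one plus
    [a(u) a(v) + a(u * v)] ([plane_ricci_shift]), which is exactly the Hessian of
    the exponential of [- a] divided by that exponential ([hessian_expRN]). As a
    flat connection has zero Ricci tensor, the equation follows.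

    The curvature formula rests on the symmetry of second derivatives
    ([derive_commute]). *)

(** * Smooth maps on the plane *)
Section SmoothCalculus.
Context {R : realType}.

Section Target.
Context {W : normedModType R}.
Implicit Types (f g : 'rV[R]_2 -> W).

Lemma smooth_differentiable f : smooth f -> forall x, differentiable f x.
Proof. by move=> /(_ 1%N) []. Qed.

Lemma smooth_derive f v : smooth f -> smooth (fun x => 'D_v f x).
Proof. by move=> sf n; case: (sf n.+1) => _; apply. Qed.

Lemma smooth_continuous f : smooth f -> continuous f.
Proof. by move=> /(_ 0%N). Qed.

Lemma smoothI f : (forall x, differentiable f x) ->
  (forall v, smooth (fun x => 'D_v f x)) -> smooth f.
Proof.
move=> df sf [|n]; last by split=> // v; apply: sf.
by move=> x; apply: differentiable_continuous.
Qed.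

Lemma is_Ck_pred n f : is_Ck n.+1 f -> is_Ck n f.
Proof.
elim: n f => [|n IHn] f [df Df]; first by move=> x; exact: differentiable_continuous.
by split=> // v; apply: IHn.
Qed.

Lemma smooth_cst (w : W) : smooth (fun=> w).
Proof.
move=> n; elim: n w => [|n IHn] w; first exact: cst_continuous.
split=> [x|v]; first exact: differentiable_cst.
by under eq_fun do rewrite derive_cst; apply: IHn.
Qed.

Lemma is_Ck_add n f g : is_Ck n f -> is_Ck n g -> is_Ck n (fun x => f x + g x).
Proof.
elim: n f g => [|n IHn] f g; first by move=> cf cg x; apply: (cvgD (cf x) (cg x)).
move=> [df Df] [dg Dg]; split=> [x|v]; first exact: differentiableD.
have -> : (fun x => 'D_v (fun y => f y + g y) x) =
          (fun x => 'D_v f x + 'D_v g x).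
  by apply/funext => x; rewrite deriveD//; apply: diff_derivable.
by apply: IHn; [apply: Df | apply: Dg].
Qed.

Lemma smooth_add f g : smooth f -> smooth g -> smooth (fun x => f x + g x).
Proof. by move=> sf sg n; apply: is_Ck_add. Qed.

Lemma smooth_sum (I : Type) (r : seq I) (F : I -> 'rV[R]_2 -> W) :
  (forall i, smooth (F i)) -> smooth (fun x => \sum_(i <- r) F i x).
Proof.
move=> sF; elim: r => [|i r IHr].
  by under eq_fun do rewrite big_nil; apply: smooth_cst.
by under eq_fun do rewrite big_cons; apply: smooth_add.
Qed.

Lemma is_Ck_scalel n (f : 'rV[R]_2 -> R) (w : W) :
  is_Ck n f -> is_Ck n (fun x => f x *: w).
Proof.
elim: n f => [|n IHn] f; first by move=> cf x; apply: (@cvgZr_tmp _ _ _ _ _ f _ w (cf x)).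
move=> [df Df]; split=> [x|v]; first exact: differentiableZl.
have -> : (fun x => 'D_v (fun y => f y *: w) x) = (fun x => 'D_v f x *: w).
  apply/funext => x.
  rewrite deriveE; last exact: differentiableZl.
  by rewrite diffZl// deriveE.
by apply: IHn; apply: Df.
Qed.

(** Smoothness is phrased with fixed directions; expanding the direction in the
    coordinate basis is what allows differentiating along a vector field. *)
Lemma derive_sum_coord f v x : differentiable f x ->
  'D_v f x = \sum_(i < 2) v ord0 i *: 'D_(delta_mx ord0 i) f x.
Proof.
move=> df; rewrite deriveE// {1}(row_sum_delta v) linear_sum.
by apply: eq_bigr => i _; rewrite linearZ deriveE.
Qed.

Lemma derive_dirD f u v x : differentiable f x ->
  'D_(u + v) f x = 'D_u f x + 'D_v f x.
Proof. by move=> df; rewrite !deriveE// linearD. Qed.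

Lemma derive_dirZ f (c : R) v x : differentiable f x ->
  'D_(c *: v) f x = c *: 'D_v f x.
Proof. by move=> df; rewrite !deriveE// linearZ. Qed.

End Target.

Lemma is_Ck_mul n (f g : 'rV[R]_2 -> R) :
  is_Ck n f -> is_Ck n g -> is_Ck n (fun x => f x * g x).
Proof.
elim: n f g => [|n IHn] f g.
  by move=> cf cg x; apply: (cvgM (cf x) (cg x)).
move=> Cf Cg; have [df Df] := Cf; have [dg Dg] := Cg.
split=> [x|v]; first exact: differentiableM.
have -> : (fun x => 'D_v (fun y => f y * g y) x) =
          (fun x => f x * 'D_v g x + g x * 'D_v f x).
  by apply/funext => x; rewrite deriveM//; apply: diff_derivable.
by apply: is_Ck_add; apply: IHn => //;
  by [apply: is_Ck_pred | apply: Df | apply: Dg].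
Qed.

Lemma smooth_mul (f g : 'rV[R]_2 -> R) :
  smooth f -> smooth g -> smooth (fun x => f x * g x).
Proof. by move=> sf sg n; apply: is_Ck_mul. Qed.

Lemma smooth_coord (X : vector_field R) i : smooth X -> smooth (fun p => X p ord0 i).
Proof.
move=> sX n; elim: n X sX => [|n IHn] X sX.
  move=> p; apply: (@continuous_comp _ _ _ X (fun M : 'rV[R]_2 => M ord0 i)).
    exact: smooth_continuous.
  exact: coord_continuous.
have dX := smooth_differentiable sX.
split=> [x|v].
  apply: (@differentiable_comp _ _ _ _ X (fun M : 'rV[R]_2 => M ord0 i)) => //.
  exact: differentiable_coord.
have -> : (fun x => 'D_v (fun p => X p ord0 i) x) = (fun x => ('D_v X x) ord0 i).
  by apply/funext => x; rewrite derive_mx ?mxE//; apply: diff_derivable.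
by apply: IHn; apply: smooth_derive.
Qed.

(** Together with [smooth_coord], this reduces products of vector-valued maps to
    products of scalar functions. *)
Lemma smooth_vector (X : vector_field R) :
  (forall i, smooth (fun p => X p ord0 i)) -> smooth X.
Proof.
move=> sX.
have -> : X = (fun p => \sum_i X p ord0 i *: delta_mx ord0 i).
  by apply/funext => p; apply: row_sum_delta.
by apply: smooth_sum => i n; apply: is_Ck_scalel; apply: sX.
Qed.

Lemma derive_coord (X : vector_field R) v p i : differentiable X p ->
  'D_v X p ord0 i = 'D_v (fun q => X q ord0 i) p.
Proof. by move=> dX; rewrite derive_mx ?mxE//; apply: diff_derivable. Qed.

End SmoothCalculus.

(** * Symmetry of second derivatives *)
Section Schwarz.
Context {R : realType}.
Implicit Types (f : 'rV[R]_2 -> R) (u v p : 'rV[R]_2).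

Lemma is_derive_line f q u (s : R) : differentiable f (q + s *: u) ->
  is_derive s 1 (fun t : R => f (q + t *: u)) ('D_u f (q + s *: u)).
Proof.
move=> df.
have E : (fun h : R => h^-1 *: (f (q + (h *: 1 + s) *: u) - f (q + s *: u))) =
         (fun h : R => h^-1 *: (f (h *: u + (q + s *: u)) - f (q + s *: u))).
  by apply/funext => h; rewrite [h *: 1]mulr1 scalerDl addrCA.
have : derivable f (q + s *: u) u by exact: diff_derivable.
by move=> dfu; apply: DeriveDef; rewrite /derivable /derive /= E.
Qed.

Lemma MVT_line f q u (t : R) : (forall x, differentiable f x) -> 0 < t ->
  exists2 s, 0 < s < t & f (q + t *: u) - f q = t * 'D_u f (q + s *: u).
Proof.
move=> df t0.
have [||s st e] := @MVT R (fun s => f (q + s *: u)) (fun s => 'D_u f (q + s *: u)) 0 t t0.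
- by move=> s _; exact: is_derive_line.
- apply: derivable_within_continuous => s _.
  by have [] := is_derive_line (df (q + s *: u)).
- exists s; first by move: st; rewrite in_itv.
  by move: e; rewrite scale0r addr0 subr0 mulrC.
Qed.

Lemma derive_translate f w u x :
  'D_u (fun y => f (y + w)) x = 'D_u f (x + w).
Proof.
rewrite /derive.
have -> // : (fun h : R => h^-1 *:
      (((fun y => f (y + w)) \o shift x) (h *: u) - f (x + w))) =
    (fun h : R => h^-1 *: ((f \o shift (x + w)) (h *: u) - f (x + w))).
by apply/funext => h /=; rewrite addrA.
Qed.

(** The second difference over the parallelogram spanned by [t *: u] and
    [t *: v] is, by the mean value theorem along [u] and then along [v],
    [t ^+ 2] times a mixed derivative at an interior point. *)
Lemma second_difference f p u v (t : R) : smooth f -> 0 < t ->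
  exists s r, [/\ 0 < s < t, 0 < r < t &
    f (p + t *: u + t *: v) - f (p + t *: u) - (f (p + t *: v) - f p) =
    t * (t * 'D_v (fun x => 'D_u f x) (p + s *: u + r *: v))].
Proof.
move=> sf t0.
have df := smooth_differentiable sf.
have sg : forall x, differentiable (fun x => f (x + t *: v)) x.
  move=> x; apply: (@differentiable_comp _ _ _ _ (fun x => x + t *: v) f) => //.
have [s st e] := @MVT_line (fun x => f (x + t *: v) - f x) p u t
  (fun x => differentiableB (sg x) (df x)) t0.
have [r rt e'] := @MVT_line (fun x => 'D_u f x) (p + s *: u) v t
  (smooth_differentiable (smooth_derive u sf)) t0.
exists s, r; split=> //; rewrite -e' e; congr (_ * _).
rewrite (@deriveB _ _ _ (fun x => f (x + t *: v)) f); [|exact: diff_derivable..].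
by rewrite derive_translate.
Qed.

(** The second difference of [second_difference] does not change when [u] and
    [v] are exchanged, so the two mixed derivatives agree at points that tend to
    [p] with [t]; by continuity they agree at [p]. *)
Lemma derive_commute f p u v : smooth f ->
  'D_v (fun x => 'D_u f x) p = 'D_u (fun x => 'D_v f x) p.
Proof.
move=> sf; apply/eqP; rewrite -subr_eq0 -normr_le0; apply/ler_addgt0Pl => e e0.
rewrite addr0.
pose g := fun x => 'D_v (fun x => 'D_u f x) x.
pose h := fun x => 'D_u (fun x => 'D_v f x) x.
have cg : g @ p --> g p by apply: smooth_continuous; do 2!apply: smooth_derive.
have ch : h @ p --> h p by apply: smooth_continuous; do 2!apply: smooth_derive.
have e2 : 0 < e / 2 by rewrite divr_gt0.
move/cvgrPdist_lt: cg => /(_ _ e2)/nbhs_normP[r1 /= r10 Hg].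
move/cvgrPdist_lt: ch => /(_ _ e2)/nbhs_normP[r2 /= r20 Hh].
(* A parallelogram of side parameter t has all its points within t * K of p. *)
pose K := 1 + `|u| + `|v|.
have K0 : 0 < K by rewrite /K -addrA ltr_pwDl// addr_ge0.
pose t := Num.min r1 r2 / K.
have t0 : 0 < t by rewrite divr_gt0// lt_min r10 r20.
have near s r : 0 < s < t -> 0 < r < t ->
    `|p - (p + s *: u + r *: v)| < Num.min r1 r2.
  move=> /andP[s0 st] /andP[rr0 rt].
  rewrite -addrA opprD addNKr normrN (le_lt_trans (ler_normD _ _))// !normrZ.
  rewrite !gtr0_norm//.
  have -> : Num.min r1 r2 = t * K by rewrite /t divfK// gt_eqF.
  rewrite /K !mulrDr mulr1 -addrA ltr_pwDl// lerD// ler_wpM2r// ltW//.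
have [s [r [hs hr]]] := second_difference p u v sf t0.
rewrite -/(g (p + s *: u + r *: v)) => E1.
have [s' [r' [hs' hr']]] := second_difference p v u sf t0.
rewrite -/(h (p + s' *: v + r' *: u)) => E2.
have tn0 : t != 0 by rewrite gt_eqF.
have E : g (p + s *: u + r *: v) = h (p + s' *: v + r' *: u).
  move: (g _) (h _) E1 E2 => G H E1 E2.
  apply: (mulfI tn0); apply: (mulfI tn0); rewrite -E1 -E2 (addrAC p (t *: v)).
  by move: (f _) (f _) (f _) (f _) => a b c d; ring.
have n1 : `|g p - g (p + s *: u + r *: v)| < e / 2.
  by apply: Hg => /=; move: (near _ _ hs hr); rewrite lt_min => /andP[].
have n2 : `|h p - h (p + s' *: v + r' *: u)| < e / 2.
  apply: Hh => /=; move: (near _ _ hr' hs').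
  by rewrite (addrAC p) lt_min => /andP[].
change (`|g p - h p| <= e).
move: (g p) (h p) (g _) (h _) E n1 n2 => a b c _ <- ca cb.
rewrite (splitr e) (le_trans (ler_distD c a b))// lerD//; first exact: ltW.
by rewrite distrC ltW.
Qed.
End Schwarz.

(** * Linear functions and their exponentials *)
Section LinearExp.
Context {R : realType}.
Lemma smooth_linear (a1 a2 : R) : smooth (linear_function a1 a2).
Proof.
have sc (i : 'I_2) : smooth (fun x : 'rV[R]_2 => x ord0 i).
  have hd v (x : 'rV[R]_2) : 'D_v (fun x : 'rV[R]_2 => x ord0 i) x = v ord0 i.
    by rewrite -(@derive_coord _ id)// derive_id.
  apply: smoothI => [x|v]; first exact: differentiable_coord.
  by under eq_fun do rewrite hd; apply: smooth_cst.
rewrite /linear_function.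
by apply: smooth_add; apply: smooth_mul => //; apply: smooth_cst.
Qed.

Lemma derive_linear (a1 a2 : R) v x :
  'D_v (linear_function a1 a2) x = linear_function a1 a2 v.
Proof.
rewrite /linear_function deriveD; [|apply: diff_derivable;
  apply: differentiableM => //; exact: differentiable_coord..].
rewrite !deriveMl; [|apply: diff_derivable; exact: differentiable_coord..].
by rewrite -!(@derive_coord _ id)// derive_id.
Qed.

Lemma differentiable_expRN (phi : 'rV[R]_2 -> R) x : differentiable phi x -> 
  differentiable (fun y => expR (- phi y)) x.
Proof.
move=> dphi; apply: (@differentiable_comp _ _ _ _ (fun y => - phi y) expR).
  exact: differentiableN.
by apply/derivable1_diffP; exact: derivable_expR.
Qed.

Lemma derive_expRN (phi : 'rV[R]_2 -> R) v x : differentiable phi x ->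
  'D_v (fun y => expR (- phi y)) x = - 'D_v phi x * expR (- phi x).
Proof.
move=> dphi; rewrite deriveE; last exact: differentiable_expRN.
rewrite (@diff_comp _ _ _ _ (fun y => - phi y) expR); last 2 first.
  exact: differentiableN.
  by apply/derivable1_diffP; exact: derivable_expR.
rewrite /= diff1E; last by apply/derivable1_diffP; exact: derivable_expR.
rewrite derive1E derive_val diffN// deriveE//.
Qed.

(** Each derivative of [expR (- phi)] is [expR (- phi)] times a smooth factor, so
    the induction is on the order alone, with [phi] fixed. *)
Lemma is_Ck_expRN n (phi : 'rV[R]_2 -> R) : smooth phi ->
  is_Ck n (fun y => expR (- phi y)).
Proof.
move=> sphi; have dphi := smooth_differentiable sphi.
elim: n => [|n IHn].
  by move=> x; apply: differentiable_continuous; apply: differentiable_expRN.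
split=> [x|v]; first exact: differentiable_expRN.
under eq_fun do rewrite derive_expRN// mulNr -mulN1r.
apply: is_Ck_mul; first exact: smooth_cst.
by apply: is_Ck_mul => //; apply: smooth_derive.
Qed.
End LinearExp.

(** * The algebra of a constant connection *)
Section Algebra.
Context {R : realType}.
Implicit Types (G : 'I_2 -> 'I_2 -> 'rV[R]_2) (u v w : 'rV[R]_2).

(** The product [u * v] of the commutative, in general non-associative, algebra
    on the tangent plane whose structure constants are the Christoffel symbols:
    the covariant derivative of the constant field [v] along [u]. *)
Definition plane_mul G u v : 'rV[R]_2 :=
  \sum_(i < 2) \sum_(j < 2) (u ord0 i * v ord0 j) *: G i j.

Lemma plane_mulDl G u v w : plane_mul G (u + v) w = plane_mul G u w + plane_mul G v w.
Proof.
rewrite -big_split; apply: eq_bigr => i _; rewrite -big_split; apply: eq_bigr => j _.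
by rewrite mxE mulrDl scalerDl.
Qed.

Lemma plane_mulDr G u v w : plane_mul G u (v + w) = plane_mul G u v + plane_mul G u w.
Proof.
rewrite -big_split; apply: eq_bigr => i _; rewrite -big_split; apply: eq_bigr => j _.
by rewrite mxE mulrDr scalerDl.
Qed.

Lemma plane_mulZl G c u v : plane_mul G (c *: u) v = c *: plane_mul G u v.
Proof.
rewrite scaler_sumr; apply: eq_bigr => i _; rewrite scaler_sumr.
by apply: eq_bigr => j _; rewrite mxE -mulrA scalerA.
Qed.

Lemma plane_mulZr G c u v : plane_mul G u (c *: v) = c *: plane_mul G u v.
Proof.
rewrite scaler_sumr; apply: eq_bigr => i _; rewrite scaler_sumr.
by apply: eq_bigr => j _; rewrite mxE mulrCA scalerA.
Qed.

Lemma plane_mul_delta G i j :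
  plane_mul G (delta_mx ord0 i) (delta_mx ord0 j) = G i j.
Proof.
rewrite /plane_mul (bigD1 i)//= (bigD1 j)//= !mxE !eqxx mulr1 scale1r.
rewrite big1 => [|k kj]; last by rewrite !mxE (negPf kj) mulr0 scale0r.
rewrite big1 => [|k ki]; first by rewrite !addr0.
by apply: big1 => l _; rewrite !mxE (negPf ki) mul0r scale0r.
Qed.

Lemma row_basis (u : 'rV[R]_2) :
  u = u ord0 0 *: delta_mx ord0 0 + u ord0 1 *: delta_mx ord0 1.
Proof.
rewrite {1}(row_sum_delta u) !big_ord_recl big_ord0 addr0.
by have -> : lift ord0 ord0 = 1 :> 'I_2 by apply: val_inj.
Qed.

Lemma plane_mulC G u v : (forall i j, G i j = G j i) ->
  plane_mul G u v = plane_mul G v u.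
Proof.
move=> symG; rewrite /plane_mul exchange_big; apply: eq_bigr => i _.
by apply: eq_bigr => j _; rewrite mulrC symG.
Qed.

Lemma linear_functionD (a1 a2 : R) u v :
  linear_function a1 a2 (u + v) = linear_function a1 a2 u + linear_function a1 a2 v.
Proof. by rewrite /linear_function !mxE; ring. Qed.

Lemma linear_functionZ (a1 a2 c : R) u :
  linear_function a1 a2 (c *: u) = c * linear_function a1 a2 u.
Proof. by rewrite /linear_function !mxE; ring. Qed.

Lemma linear_function_sum (a1 a2 : R) u :
  linear_function a1 a2 u =
  \sum_(k < 2) u ord0 k * linear_function a1 a2 (delta_mx ord0 k).
Proof.
rewrite {1}(row_sum_delta u) !big_ord_recl !big_ord0 !addr0.
by rewrite linear_functionD !linear_functionZ.
Qed.

(** The structure constants of [u * v + a(v) u + a(u) v], that is, the Christoffel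
    symbols of the strongly projectively equivalent connection. *)
Definition projective_shift (a1 a2 : R) G : 'I_2 -> 'I_2 -> 'rV[R]_2 :=
  fun i j => G i j + linear_function a1 a2 (delta_mx ord0 j) *: delta_mx ord0 i
                   + linear_function a1 a2 (delta_mx ord0 i) *: delta_mx ord0 j.

Lemma plane_mul_shift a1 a2 G u v :
  plane_mul (projective_shift a1 a2 G) u v =
  plane_mul G u v + linear_function a1 a2 v *: u + linear_function a1 a2 u *: v.
Proof.
have aE := linear_function_sum a1 a2; set a := linear_function a1 a2 in aE *.
rewrite (aE u) (aE v).
have E w w' : (\sum_(k < 2) w ord0 k * a (delta_mx ord0 k)) *: w' =
    \sum_(i < 2) \sum_(j < 2) (w' ord0 i * w ord0 j * a (delta_mx ord0 j)) *: delta_mx ord0 i.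
  rewrite {1}(row_sum_delta w') scaler_sumr; apply: eq_bigr => i _.
  rewrite scalerA -scaler_suml; congr (_ *: _); rewrite mulr_suml.
  by apply: eq_bigr => j _; ring.
rewrite E [X in _ = _ + X]E [X in _ = _ + X]exchange_big -!big_split.
apply: eq_bigr => i _; rewrite -!big_split; apply: eq_bigr => j _ /=.
by rewrite !scalerDr !scalerA (mulrC (v ord0 j)).
Qed.

(** The trace of [z |-> z * (u * v) - u * (z * v)]; by [curvature_constant] this is
    the Ricci tensor of the connection with Christoffel symbols [G]. *)
Definition plane_ricci G u v : R :=
  \sum_(i < 2) (plane_mul G (delta_mx ord0 i) (plane_mul G u v)
    - plane_mul G u (plane_mul G (delta_mx ord0 i) v)) ord0 i.

(** Writing [a] for the linear form, the [z]-dependence of the curvature of the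
    shifted product differs from the original one by
    [(a(u * v) + a(u) a(v)) z - (a(v) a(z) + a(z * v)) u]. The trace of the first
    term counts the dimension 2, that of the second one evaluates at [z = u]. The
    extra terms are those of the Hessian of the exponential of [- a], see
    [hessian_expRN]. *)
Lemma plane_ricci_shift a1 a2 G u v : (forall i j, G i j = G j i) ->
  plane_ricci (projective_shift a1 a2 G) u v =
  plane_ricci G u v + linear_function a1 a2 (plane_mul G u v)
  + linear_function a1 a2 u * linear_function a1 a2 v.
Proof.
move=> symG.
have aD := linear_functionD a1 a2; have aZ := linear_functionZ a1 a2.
have aS := linear_function_sum a1 a2; have MS := plane_mul_shift a1 a2 G.
move: (linear_function a1 a2) aD aZ aS MS => a aD aZ aS MS.
have E (i : 'I_2) : (let M := plane_mul (projective_shift a1 a2 G) in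
    M (delta_mx ord0 i) (M u v) - M u (M (delta_mx ord0 i) v)) ord0 i =
  (plane_mul G (delta_mx ord0 i) (plane_mul G u v)
    - plane_mul G u (plane_mul G (delta_mx ord0 i) v)) ord0 i
  + (a (plane_mul G u v) + a u * a v) - u ord0 i * 
    (a v * a (delta_mx ord0 i) + a (plane_mul G (delta_mx ord0 i) v)).
  rewrite /= !MS !plane_mulDr !plane_mulZr !aD !aZ.
  by rewrite (plane_mulC u (delta_mx _ _) symG) !mxE !eqxx mulr1n; ring.
rewrite /plane_ricci (eq_bigr _ (fun i _ => E i)) big_split big_split /=.
rewrite sumr_const card_ord sumrN.
have -> : \sum_(i < 2) u ord0 i *
    (a v * a (delta_mx ord0 i) + a (plane_mul G (delta_mx ord0 i) v)) =
    a u * a v + a (plane_mul G u v).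
  have -> : a (plane_mul G u v) =
      \sum_(i < 2) u ord0 i * a (plane_mul G (delta_mx ord0 i) v).
    rewrite {1}(row_sum_delta u) !big_ord_recl !big_ord0 !addr0.
    by rewrite plane_mulDl !plane_mulZl aD !aZ.
  rewrite [a u]aS mulr_suml -big_split.
  by apply: eq_bigr => i _ /=; ring.
by ring.
Qed.

(** [frame0 t], [frame1 t] is the standard basis rotated by the angle [t]; using an
    orthonormal frame makes [dot] compute the coordinates in it. *)
Definition frame0 (t : R) : 'rV[R]_2 := cos t *: delta_mx ord0 0 + sin t *: delta_mx ord0 1.
Definition frame1 (t : R) : 'rV[R]_2 := - sin t *: delta_mx ord0 0 + cos t *: delta_mx ord0 1.
Definition dot u v : R := u ord0 0 * v ord0 0 + u ord0 1 * v ord0 1.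

Lemma frame_expansion t u : u = dot u (frame0 t) *: frame0 t + dot u (frame1 t) *: frame1 t.
Proof.
have cs := cos2sin2 t; apply/rowP => k.
change (u ord0 k = (dot u (frame0 t) *: frame0 t + dot u (frame1 t) *: frame1 t) ord0 k).
have [-> | ->] : k = 0 \/ k = 1.
- by case: k => [[|[|//]] ?]; [left | right]; apply: val_inj.
- rewrite /dot /frame0 /frame1 !mxE /=; ring: cs.
- by rewrite /dot /frame0 /frame1 !mxE /=; ring: cs.
Qed.

(** The component of [x * x] across [x], for [x] the rotated first basis vector, is
    a homogeneous cubic in the frame; it changes sign under the half-turn that
    sends the frame to its opposite, so it vanishes for some angle. There [x * x]
    is a multiple of [x]. *)
Lemma eigendirection G :
  exists t, dot (plane_mul G (frame0 t) (frame0 t)) (frame1 t) = 0.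
Proof.
pose f t := dot (plane_mul G (frame0 t) (frame0 t)) (frame1 t).
have fpi : f pi = - f 0.
  have xpi : frame0 pi = -1 *: frame0 0.
    by rewrite /frame0 cospi sinpi cos0 sin0 !scale0r !addr0 scale1r.
  have ypi : frame1 pi = -1 *: frame1 0.
    by rewrite /frame1 cospi sinpi cos0 sin0 !oppr0 !scale0r !add0r scale1r.
  rewrite /f xpi ypi plane_mulZl plane_mulZr scalerA mulrNN mulr1 scale1r.
  by rewrite /dot !mxE; ring.
have cf : continuous f.
  pose q k (t : R) := cos t * cos t * G 0 0 ord0 k + cos t * sin t * G 0 1 ord0 k
    + sin t * cos t * G 1 0 ord0 k + sin t * sin t * G 1 1 ord0 k.
  have -> : f = fun t => q 0 t * - sin t + q 1 t * cos t.
    apply/funext => t; rewrite /f /frame0 !plane_mulDl !plane_mulDr.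
    rewrite !plane_mulZl !plane_mulZr !plane_mul_delta /dot /frame1 /q !mxE /=.
    by ring.
  by move=> t; repeat (apply: cvgD || apply: cvgM || apply: cvgN ||
    apply: continuous_cos || apply: continuous_sin || apply: cvg_cst).
have [|||t _ ft] := @IVT R f 0 pi 0.
- exact: pi_ge0.
- exact: continuous_subspaceT.
- rewrite fpi; have [f0|f0] := leP 0 (f 0); rewrite ge_min le_max; lra.
by exists t.
Qed.

(** Let [x * x = P x] (see [eigendirection]) and [x * y = Q x + S y], with [y]
    orthogonal to [x]. The form with [a(x) = S - P] and [a(y) = - Q] makes
    multiplication by [x] in the shifted algebra equal to the scalar [2 S - P]: the
    value at [y] cancels the [x]-component of [x * y], and the value at [x] equates
    the two remaining coefficients. The multiplication operators are then all in
    the span of the identity and the multiplication by [y], hence commute. *)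
Lemma commuting_shift G : (forall i j, G i j = G j i) -> exists a1 a2,
  let M := plane_mul (projective_shift a1 a2 G) in
  forall u v w, M u (M v w) = M v (M u w).
Proof.
move=> symG; have [t ft] := eigendirection G.
pose x := frame0 t; pose y := frame1 t.
pose P := dot (plane_mul G x x) x.
pose Q := dot (plane_mul G x y) x.
pose S := dot (plane_mul G x y) y.
have xx : plane_mul G x x = P *: x.
  by rewrite [LHS](frame_expansion t) ft scale0r addr0.
have xy : plane_mul G x y = Q *: x + S *: y by exact: frame_expansion.
have cs := cos2sin2 t.
(* The coordinates of the form with value S - P at x and - Q at y. *)
pose a1 := (S - P) * cos t + Q * sin t; pose a2 := (S - P) * sin t - Q * cos t.
exists a1, a2.
have ax : linear_function a1 a2 x = S - P.
  by rewrite /linear_function /x /frame0 !mxE /= /a1 /a2; ring: cs.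
have ay : linear_function a1 a2 y = - Q.
  by rewrite /linear_function /y /frame1 !mxE /= /a1 /a2; ring: cs.
have MDl := plane_mulDl (projective_shift a1 a2 G).
have MDr := plane_mulDr (projective_shift a1 a2 G).
have MZl := plane_mulZl (projective_shift a1 a2 G).
have MZr := plane_mulZr (projective_shift a1 a2 G).
have ME := plane_mul_shift a1 a2 G.
move: (plane_mul (projective_shift _ _ _)) MDl MDr MZl MZr ME => M MDl MDr MZl MZr ME /=.
have Mx u : M x u = (2 * S - P) *: u.
  have Mxx : M x x = (2 * S - P) *: x.
    by rewrite ME xx ax -!scalerDl; congr (_ *: _); ring.
  have Mxy : M x y = (2 * S - P) *: y.
    rewrite ME xy ax ay scaleNr addrAC [Q *: x + _ + _]addrAC.
    by rewrite -addrA -scalerDl addrAC subrr add0r; congr (_ *: _); ring.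
  rewrite [u](frame_expansion t) MDr !MZr Mxx Mxy [RHS]scalerDr !scalerA.
  by rewrite !(mulrC (2 * S - P)).
move=> u v w.
have E u' w' : M u' w' = (dot u' x * (2 * S - P)) *: w' + dot u' y *: M y w'.
  by rewrite {1}(frame_expansion t u') MDl !MZl Mx scalerA.
rewrite (E u) (E v w) (E v (M u w)) (E u w) !MDr !MZr !scalerDr !scalerA.
by apply/rowP => k; rewrite !mxE; ring.
Qed.
End Algebra.

(** * Connections with constant coefficients *)
Section Connections.
Context {R : realType}.
Implicit Types (X Y Z : vector_field R) (f : 'rV[R]_2 -> R) (p v : 'rV[R]_2)
  (G : 'I_2 -> 'I_2 -> 'rV[R]_2) (nabla : field_operator R).

Lemma smooth_scale f X : smooth f -> smooth X -> smooth (fun p => f p *: X p).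
Proof.
move=> sf sX; apply: smooth_vector => i; under eq_fun do rewrite mxE.
by apply: smooth_mul => //; apply: smooth_coord.
Qed.

Lemma smooth_derive_along X Y : smooth X -> smooth Y -> smooth (fun p => 'D_(X p) Y p).
Proof.
move=> sX sY; under eq_fun do rewrite (derive_sum_coord _ (smooth_differentiable sY _)).
apply: smooth_sum => i; apply: smooth_scale; first exact: smooth_coord.
exact: smooth_derive.
Qed.

Lemma smooth_plane_mul G X Y : smooth X -> smooth Y ->
  smooth (fun p => plane_mul G (X p) (Y p)).
Proof.
move=> sX sY; apply: smooth_sum => i; apply: smooth_sum => j n.
apply: is_Ck_scalel; apply: is_Ck_mul; exact: smooth_coord.
Qed.

Lemma derive_bigsum (W : normedModType R) n (F : 'I_n -> 'rV[R]_2 -> W) v p :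
  (forall i, differentiable (F i) p) ->
  'D_v (fun q => \sum_(i < n) F i q) p = \sum_(i < n) 'D_v (F i) p.
Proof.
move=> dF; rewrite -derive_sum => [|i]; last exact: diff_derivable.
by congr ('D_v _ p); apply/funext => q; rewrite fct_sumE.
Qed.

Lemma derive_scale f X v p : smooth f -> smooth X ->
  'D_v (fun q => f q *: X q) p = 'D_v f p *: X p + f p *: 'D_v X p.
Proof.
move=> sf sX; apply/rowP => i.
rewrite [LHS]derive_coord; last exact: smooth_differentiable (smooth_scale sf sX) _.
under [X in 'D_v X p]eq_fun do rewrite mxE.
rewrite !mxE (derive_coord v i (smooth_differentiable sX p)).
rewrite deriveM; last 2 first.
- exact: diff_derivable (smooth_differentiable sf p).
- exact: diff_derivable (smooth_differentiable (smooth_coord i sX) p).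
by rewrite addrC; congr (_ + _); apply: mulrC.
Qed.

Lemma derive_plane_mul G X Y v p : smooth X -> smooth Y ->
  'D_v (fun q => plane_mul G (X q) (Y q)) p =
  plane_mul G ('D_v X p) (Y p) + plane_mul G (X p) ('D_v Y p).
Proof.
move=> sX sY.
have sXi i := smooth_coord i sX; have sYi i := smooth_coord i sY.
have dXY i j : differentiable (fun q => X q ord0 i * Y q ord0 j) p.
  by apply: smooth_differentiable; apply: smooth_mul.
rewrite derive_bigsum => [|i]; last first.
  have : smooth (fun q => \sum_(j < 2) (X q ord0 i * Y q ord0 j) *: G i j).
    apply: smooth_sum => j n; apply: is_Ck_scalel.
    by apply: is_Ck_mul; [apply: sXi | apply: sYi].
  by move=> /smooth_differentiable.
rewrite -big_split; apply: eq_bigr => i _.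
rewrite derive_bigsum => [|j]; last exact: differentiableZl.
rewrite -big_split; apply: eq_bigr => j _.
rewrite deriveE; last exact: differentiableZl.
rewrite diffZl// -deriveE// /= -scalerDl; congr (_ *: _).
rewrite deriveM; last 2 first.
- exact: diff_derivable (smooth_differentiable (sXi i) p).
- exact: diff_derivable (smooth_differentiable (sYi j) p).
rewrite -!derive_coord; try exact: smooth_differentiable.
by rewrite addrC; congr (_ + _); rewrite [LHS]mulrC.
Qed.

(** The part of the derivative that comes from the variation of [X] is isolated, so
    that in a commutator of two such derivatives it forms the Lie bracket, the
    frozen part being symmetric by [derive_commute_field]. *)
Lemma derive_along_field X Z v p : smooth X -> smooth Z ->
  'D_v (fun q => 'D_(X q) Z q) p =
  'D_('D_v X p) Z p + 'D_v (fun q => 'D_(X p) Z q) p.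
Proof.
move=> sX sZ; have dZ := smooth_differentiable sZ.
have sDZ i := @smooth_derive _ _ Z (delta_mx ord0 i) sZ.
have E (Y : vector_field R) : smooth Y -> 'D_v (fun q => 'D_(Y q) Z q) p =
    \sum_(i < 2) ('D_v Y p ord0 i *: 'D_(delta_mx ord0 i) Z p +
      Y p ord0 i *: 'D_v (fun q => 'D_(delta_mx ord0 i) Z q) p).
  move=> sY; under [X in 'D_v X p]eq_fun do rewrite (derive_sum_coord _ (dZ _)).
  rewrite derive_bigsum => [|i]; last first.
    by apply: smooth_differentiable; apply: smooth_scale => //; apply: smooth_coord.
  apply: eq_bigr => i _; rewrite derive_scale//; last exact: smooth_coord.
  by rewrite (derive_coord v i (smooth_differentiable sY p)).
rewrite E// (E (cst (X p))); last exact: smooth_cst.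
rewrite (derive_sum_coord _ (dZ p)) -big_split; apply: eq_bigr => i _ /=.
by rewrite derive_cst mxE scale0r add0r.
Qed.

Lemma derive_commute_field Z u v p : smooth Z ->
  'D_v (fun q => 'D_u Z q) p = 'D_u (fun q => 'D_v Z q) p.
Proof.
move=> sZ; have dZ := smooth_differentiable sZ; apply/rowP => i.
have D w w' : ('D_w (fun q => 'D_w' Z q) p) ord0 i =
    'D_w (fun q => 'D_w' (fun x => Z x ord0 i) q) p.
  rewrite derive_coord; last exact: smooth_differentiable (smooth_derive _ sZ) _.
  by under [X in 'D_w X p]eq_fun do rewrite (derive_coord _ _ (dZ _)).
by rewrite [LHS]D [RHS]D derive_commute//; apply: smooth_coord.
Qed.

Definition constant_connection G : field_operator R :=
  fun X Y p => 'D_(X p) Y p + plane_mul G (X p) (Y p).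

Lemma smooth_constant_connection G X Y : smooth X -> smooth Y ->
  smooth (constant_connection G X Y).
Proof.
move=> sX sY; apply: smooth_add; first exact: smooth_derive_along.
exact: smooth_plane_mul.
Qed.

Lemma smooth_lie_bracket X Y : smooth X -> smooth Y -> smooth (lie_bracket X Y).
Proof.
move=> sX sY.
have -> : lie_bracket X Y = (fun p => 'D_(X p) Y p + (cst (- 1 : R) p) *: 'D_(Y p) X p).
  by apply/funext => p; rewrite /lie_bracket scaleN1r.
apply: smooth_add; first exact: smooth_derive_along.
by apply: smooth_scale; [exact: smooth_cst | exact: smooth_derive_along].
Qed.

(** The derivative terms cancel as they do for the flat connection of the plane,
    the mixed products cancel in pairs, and the bracket absorbs the derivatives of
    [X] and [Y]; the commutator of two multiplications is left. *)
Lemma curvature_constant G X Y Z p : smooth X -> smooth Y -> smooth Z ->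
  curvature (constant_connection G) X Y Z p =
  plane_mul G (X p) (plane_mul G (Y p) (Z p)) -
  plane_mul G (Y p) (plane_mul G (X p) (Z p)).
Proof.
move=> sX sY sZ; have dZ := smooth_differentiable sZ.
have dd (A B : vector_field R) : smooth A -> smooth B ->
    forall q, differentiable (fun x => 'D_(A x) B x) q.
  by move=> sA sB; apply: smooth_differentiable; apply: smooth_derive_along.
have dm (A B : vector_field R) : smooth A -> smooth B ->
    forall q, differentiable (fun x => plane_mul G (A x) (B x)) q.
  by move=> sA sB; apply: smooth_differentiable; apply: smooth_plane_mul.
have E (A B : vector_field R) : smooth A -> smooth B ->
    constant_connection G A (constant_connection G B Z) p =
    'D_('D_(A p) B p) Z p + 'D_(A p) (fun q => 'D_(B p) Z q) p
    + (plane_mul G ('D_(A p) B p) (Z p) + plane_mul G (B p) ('D_(A p) Z p))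
    + (plane_mul G (A p) ('D_(B p) Z p)
       + plane_mul G (A p) (plane_mul G (B p) (Z p))).
  move=> sA sB; rewrite {1}/constant_connection /constant_connection plane_mulDr.
  rewrite deriveD; last 2 first.
  - exact: diff_derivable (dd _ _ sB sZ p).
  - exact: diff_derivable (dm _ _ sB sZ p).
  by rewrite (derive_along_field (A p) p sB sZ)
             (derive_plane_mul G (A p) p sB sZ).
rewrite /curvature E// E// /constant_connection /lie_bracket.
rewrite (derive_commute_field (Y p) (X p) p sZ).
rewrite -(scaleN1r ('D_(Y p) X p)) derive_dirD// derive_dirZ// plane_mulDl plane_mulZl.
move: ('D_('D_(X p) Y p) Z p) ('D_('D_(Y p) X p) Z p)
      ('D_(X p) (fun q => 'D_(Y p) Z q) p).
move: ('D_(X p) Y p) ('D_(Y p) X p) ('D_(X p) Z p) ('D_(Y p) Z p).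
move=> xy yx xz yz dxy dyx dxdyz; apply/rowP => k; rewrite !mxE; ring.
Qed.

Lemma type_A_constant G : (forall i j, G i j = G j i) ->
  type_A (constant_connection G).
Proof.
move=> symG; split; first split.
- split.
  + exact: smooth_constant_connection.
  + move=> X X' Y sX sX' sY p; rewrite /constant_connection /=.
    rewrite derive_dirD; last exact: smooth_differentiable.
    by rewrite plane_mulDl addrACA.
  + move=> f X Y sf sX sY p; rewrite /constant_connection.
    rewrite derive_dirZ; last exact: smooth_differentiable.
    by rewrite plane_mulZl scalerDr.
  + move=> X Y Y' sX sY sY' p; rewrite /constant_connection /=.
    rewrite deriveD; [|exact: diff_derivable (smooth_differentiable _ _)..].
    by rewrite plane_mulDr addrACA.
  + move=> f X Y sf sX sY p; rewrite /constant_connection.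
    by rewrite derive_scale// plane_mulZr scalerDr addrA.
- move=> X Y sX sY p; rewrite /constant_connection /lie_bracket (plane_mulC (Y p) (X p) symG).
  by rewrite opprD addrACA subrr addr0.
- move=> i j k; exists (G i j ord0 k) => p.
  by rewrite /christoffel /constant_connection /coord_field derive_cst add0r plane_mul_delta.
Qed.

Lemma field_sum_coord X :
  X = (fun p => X p ord0 0 *: coord_field 0 p)
      \+ (fun p => X p ord0 1 *: coord_field 1 p).
Proof. by apply/funext => p; exact: row_basis. Qed.

(** The axioms of a connection determine it on smooth fields by its values on the
    coordinate fields; these are constant, and symmetric because coordinate fields
    have zero bracket. *)
Lemma type_A_is_constant nabla : type_A nabla -> exists G,
  (forall i j, G i j = G j i) /\
  forall X Y, smooth X -> smooth Y -> nabla X Y = constant_connection G X Y.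
Proof.
move=> [[cn tf] cst_n].
pose G i j := nabla (coord_field i) (coord_field j) 0.
have sc i : smooth (@coord_field R i) by exact: smooth_cst.
have GE i j p : nabla (coord_field i) (coord_field j) p = G i j.
  apply/rowP => k; have [c ck] := cst_n i j k.
  by rewrite -[LHS]/(christoffel nabla i j k p) -[RHS]/(christoffel nabla i j k 0) !ck.
exists G; split=> [i j|X Y sX sY].
  apply/eqP; rewrite -subr_eq0; apply/eqP.
  by rewrite (tf _ _ (sc i) (sc j) 0) /lie_bracket /coord_field !derive_cst subrr.
have sXi i := smooth_coord i sX; have sYi i := smooth_coord i sY.
have sXe i := smooth_scale (sXi i) (sc i); have sYe i := smooth_scale (sYi i) (sc i).
apply/funext => p.
have nXe j : nabla X (coord_field j) p =
    X p ord0 0 *: G 0 j + X p ord0 1 *: G 1 j.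
  rewrite {1}(field_sum_coord X) (connection_addl cn)//.
  by rewrite !(connection_scalel cn)// !GE.
rewrite {1}(field_sum_coord Y) (connection_addr cn)// !(connection_leibniz cn)// !nXe.
rewrite /constant_connection (row_basis ('D_(X p) Y p)).
rewrite !(derive_coord _ _ (smooth_differentiable sY p)).
have -> : plane_mul G (X p) (Y p) =
    X p ord0 0 *: (Y p ord0 0 *: G 0 0 + Y p ord0 1 *: G 0 1) +
    X p ord0 1 *: (Y p ord0 0 *: G 1 0 + Y p ord0 1 *: G 1 1).
  rewrite {1}(row_basis (X p)) {1}(row_basis (Y p)).
  by rewrite plane_mulDl !plane_mulZl !plane_mulDr !plane_mulZr !plane_mul_delta.
rewrite /coord_field.
by apply/rowP => k; rewrite !mxE; ring.
Qed.

End Connections.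

(** * The Hessian of the exponential *)
Section ExpHessian.
Context {R : realType}.

(** Differentiating the exponential of [- phi] along [v] multiplies it by
    [- phi v]; the sign of the first-order term of the Hessian makes it
    [+ phi (X * Y)], in agreement with [plane_ricci_shift]. *)
Lemma hessian_expRN (nabla : field_operator R) (G : 'I_2 -> 'I_2 -> 'rV[R]_2)
    a1 a2 (X Y : vector_field R) p :
  (forall i j k q, christoffel nabla i j k q = G i j ord0 k) ->
  let phi := linear_function a1 a2 in
  hessian nabla (fun x => expR (- phi x)) X Y p =
  expR (- phi p) * (phi (X p) * phi (Y p) + phi (plane_mul G (X p) (Y p))).
Proof.
move=> chG phi.
have dphi x : differentiable phi x := smooth_differentiable (smooth_linear a1 a2) x.
have D1 i : partial_derivative i (fun x => expR (- phi x)) =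
    (fun x => - phi (delta_mx ord0 i) * expR (- phi x)).
  apply/funext => x; rewrite /partial_derivative derive_expRN//.
  by rewrite derive_linear.
have D2 i j q : partial_derivative i (partial_derivative j (fun x => expR (- phi x))) q =
    phi (delta_mx ord0 i) * phi (delta_mx ord0 j) * expR (- phi q).
  rewrite D1 /partial_derivative deriveMl; last first.
    exact: diff_derivable (differentiable_expRN (dphi q)).
  rewrite derive_expRN// derive_linear -/phi.
  by move: (phi _) (phi _) => a b; ring.
have phiS := linear_function_sum a1 a2; rewrite -/phi in phiS.
have phi_sum (F : 'I_2 -> 'rV[R]_2) : phi (\sum_(i < 2) F i) = \sum_(i < 2) phi (F i).
  apply: (big_morph phi (linear_functionD a1 a2)).
  by rewrite /phi /linear_function !mxE !mulr0 addr0.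
rewrite mulrDr (phiS (X p)) (phiS (Y p)) mulr_suml /plane_mul phi_sum !mulr_sumr.
rewrite -big_split; apply: eq_bigr => i _ /=.
rewrite phi_sum !mulr_sumr -big_split; apply: eq_bigr => j _ /=.
rewrite D2 [phi (_ *: _)]linear_functionZ -/phi (phiS (G i j)).
under eq_bigr do rewrite D1 chG.
have -> : \sum_(k < 2) G i j ord0 k * (- phi (delta_mx ord0 k) * expR (- phi p)) =
    - ((\sum_(k < 2) G i j ord0 k * phi (delta_mx ord0 k)) * expR (- phi p)).
  by rewrite mulr_suml -sumrN; apply: eq_bigr => k _; ring.
move: (phi _) (phi _) (expR _) (\sum_(k < 2) _) => a b e c; ring.
Qed.

End ExpHessian.

Theorem lemma1p1 (R : realType) (nabla : field_operator R)
    (nablaA : type_A nabla) :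
  exists a1 a2 : R,
    let phi := linear_function a1 a2 in
    (exists nabla' : field_operator R,
      [/\ strong_projective_equivalence phi nabla nabla',
          type_A nabla' & flat nabla']) /\
    quasi_einstein_solution nabla (fun x => expR (- phi x)).
Proof.
have [G [symG nablaE]] := type_A_is_constant nablaA.
have [a1 [a2 comm]] := commuting_shift symG.
exists a1, a2 => phi.
pose G' := projective_shift a1 a2 G.
have symG' i j : G' i j = G' j i.
  by rewrite /G' /projective_shift symG addrAC.
have se i : smooth (@coord_field R i) by exact: smooth_cst.
have flat' : flat (constant_connection G').
  move=> X Y Z sX sY sZ p.
  by rewrite curvature_constant// comm subrr.
split.
  exists (constant_connection G'); split=> //; last exact: type_A_constant.
  split; first exact: smooth_linear.
  move=> X Y sX sY p.
  rewrite nablaE// /constant_connection plane_mul_shift !addrA.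
  by rewrite !derive_linear.
split; first by move=> n; apply: is_Ck_expRN; exact: smooth_linear.
have curvE X Y Z p : smooth X -> smooth Y -> smooth Z ->
    curvature nabla X Y Z p = curvature (constant_connection G) X Y Z p.
  move=> sX sY sZ; rewrite /curvature !nablaE//; try exact: smooth_constant_connection.
  exact: smooth_lie_bracket.
have ricE X Y p : smooth X -> smooth Y -> ricci nabla X Y p = plane_ricci G (X p) (Y p).
  move=> sX sY; apply: eq_bigr => i _.
  by rewrite mxE curvE// curvature_constant.
have ric' u v : plane_ricci G' u v = 0.
  by apply: big1 => i _; rewrite comm subrr mxE.
have ricG u v : plane_ricci G u v = - (phi (plane_mul G u v) + phi u * phi v).
  by apply/eqP; rewrite -subr_eq0 opprK addrA -plane_ricci_shift// ric'.
move=> X Y sX sY p.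
have chG i j k q : christoffel nabla i j k q = G i j ord0 k.
  by rewrite /christoffel nablaE// /constant_connection derive_cst add0r plane_mul_delta.
rewrite (hessian_expRN _ _ _ _ _ chG) -/phi /ricci_sym !ricE// !ricG.
rewrite (plane_mulC (Y p) (X p) symG).
by field.
Qed.
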